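(* The braid group $B_n$ admits a (redundant) group presentation with generators the classical braid generators $\sigma_i$ and the clasp generators $p_i$, $1\le i\le n-1$, and relations $$\begin{array}{lrcll} 1) & \sigma_i\sigma_j & = & \sigma_j\sigma_i & \text{for } |i-j|>1\\ 2) & \sigma_i\sigma_{i+1}\sigma_i & = & \sigma_{i+1}\sigma_i\sigma_{i+1} & \text{for } 1\le i<n-1\\ 3) & p_ip_{i+2} & = & p_{i+2}p_i & \text{for } 1\le i<n-2\\ 4) & (\sigma_ip_{i+1}\sigma_i)p_{i+1} & = & p_{i+1}(\sigma_ip_{i+1}\sigma_i) & \text{for } 1\le i<n-1\\ 5) & p_i\sigma_j & = & \sigma_jp_i & \text{for } |i-j|>1\\ 6) & p_i\sigma_i & = & \sigma_ip_i & \text{for } 1\le i<n\\ 7) & p_i\sigma_{i+1}\sigma_i & = & \sigma_{i+1}\sigma_ip_{i+1} & \text{for } 1\le i<n-1\\ 8) & \sigma_i\sigma_{i+1}p_i & = & p_{i+1}\sigma_i\sigma_{i+1} & \text{for } 1\le i<n-1\\ 9) & p_i & = & \sigma_i^2 & \text{for } 1\le i<n. \end{array}$$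
   Context: $B_n$ is the Artin braid group with generators $\sigma_1,\dots,\sigma_{n-1}$ and relations $\sigma_i\sigma_j=\sigma_j\sigma_i$ for $|i-j|>1$ and $\sigma_i\sigma_{i+1}\sigma_i=\sigma_{i+1}\sigma_i\sigma_{i+1}$ for $1\le i\le n-2$. The clasp generator $p_i$ corresponds to the element $\sigma_i^2\in B_n$. *)

(* Defs.v *)
From HB Require Import structures.
From mathcomp Require Import all_boot ssrint boolp.

Set Implicit Arguments.
Unset Strict Implicit.
Unset Printing Implicit Defensive.

Local Open Scope group_scope.
Local Open Scope quotient_scope.

(* The letter (x, false) stands for the generator x and (x, true) for its
   formal inverse. *)
Definition word (X : Type) : Type := seq (X * bool).

Definition word_inv (X : Type) (w : word X) : word X :=
  rev [seq (l.1, ~~ l.2) | l <- w].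

Lemma word_invK (X : Type) : involutive (@word_inv X).
Proof.
move=> w; rewrite /word_inv map_rev revK -map_comp -[RHS]map_id.
by apply: eq_map => -[x b] /=; rewrite negbK.
Qed.

(* The congruence on words generated by free cancellation and by the relations
   u = v such that R u v. *)
Inductive word_cong (X : Type) (R : word X -> word X -> Prop) :
    word X -> word X -> Prop :=
| word_cong_refl u : word_cong R u u
| word_cong_sym u v : word_cong R u v -> word_cong R v u
| word_cong_trans u v w :
    word_cong R u v -> word_cong R v w -> word_cong R u w
| word_cong_cat u u' v v' :
    word_cong R u u' -> word_cong R v v' -> word_cong R (u ++ v) (u' ++ v')
| word_cong_cancel x b : word_cong R [:: (x, b); (x, ~~ b)] [::]
| word_cong_rel u v : R u v -> word_cong R u v.

Lemma word_cong_catV (X : Type) (R : word X -> word X -> Prop) (w : word X) :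
  word_cong R (w ++ word_inv w) [::].
Proof.
elim: w => [|[x b] w IHw]; first exact: word_cong_refl.
have -> : ((x, b) :: w) ++ word_inv ((x, b) :: w)
          = [:: (x, b)] ++ (w ++ word_inv w) ++ [:: (x, ~~ b)].
  by rewrite /word_inv map_cons rev_cons -cats1 -!catA.
apply: word_cong_trans (word_cong_cancel R x b).
apply: (word_cong_cat (word_cong_refl R [:: (x, b)])).
exact: (word_cong_cat IHw (word_cong_refl R [:: (x, ~~ b)])).
Qed.

Section Presented.
Variables (X : choiceType) (R : word X -> word X -> Prop).

Definition word_congb : rel (seq (X * bool)) :=
  fun u v => `[< word_cong R u v >].

Lemma word_congb_refl : reflexive word_congb.
Proof. by move=> u; apply/asboolP; apply: word_cong_refl. Qed.

Lemma word_congb_sym : symmetric word_congb.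
Proof. by move=> u v; apply/asboolP/asboolP; apply: word_cong_sym. Qed.

Lemma word_congb_trans : transitive word_congb.
Proof.
move=> v u w /asboolP uv /asboolP vw; apply/asboolP.
exact: word_cong_trans uv vw.
Qed.

Canonical word_congb_equiv :=
  EquivRel word_congb word_congb_refl word_congb_sym word_congb_trans.

(* The group < X | R >, with the group structure declared below. *)
Definition presented : Type := {eq_quot word_congb}.
HB.instance Definition _ := Choice.on presented.
HB.instance Definition _ := Quotient.on presented.

Definition presented_class (w : word X) : presented := \pi_presented w.

Lemma presented_classP (u v : word X) :
  presented_class u = presented_class v <-> word_cong R u v.
Proof.
split=> [|uv]; first by move/eqmodP/asboolP.
by apply/eqmodP/asboolP.
Qed.

Lemma presented_classK : cancel repr presented_class.
Proof. by move=> a; apply: reprK. Qed.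

Lemma repr_presented_class (w : word X) :
  word_cong R (repr (presented_class w)) w.
Proof. by apply/presented_classP; rewrite presented_classK. Qed.

Definition presented_one : presented := presented_class [::].
Definition presented_mul (a b : presented) : presented :=
  presented_class (repr a ++ repr b).
Definition presented_inv (a : presented) : presented :=
  presented_class (word_inv (repr a)).

Lemma presented_mul_class (u v : word X) :
  presented_mul (presented_class u) (presented_class v)
    = presented_class (u ++ v).
Proof.
by apply/presented_classP/word_cong_cat; apply: repr_presented_class.
Qed.

Lemma presented_mulA : associative presented_mul.
Proof.
move=> a b c.
rewrite -[a]presented_classK -[b]presented_classK -[c]presented_classK.
by rewrite !presented_mul_class catA.
Qed.

Lemma presented_mul1 : left_id presented_one presented_mul.
Proof. by move=> a; rewrite -[a]presented_classK presented_mul_class. Qed.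

Lemma presented_mulr1 : right_id presented_one presented_mul.
Proof.
by move=> a; rewrite -[a]presented_classK presented_mul_class cats0.
Qed.

Lemma presented_mulV : left_inverse presented_one presented_inv presented_mul.
Proof.
move=> a; rewrite -{2}[a]presented_classK presented_mul_class.
apply/presented_classP; rewrite -{2}[repr a]word_invK.
exact: word_cong_catV.
Qed.

Lemma presented_mulrV : right_inverse presented_one presented_inv presented_mul.
Proof.
move=> a; rewrite -{1}[a]presented_classK presented_mul_class.
by apply/presented_classP; apply: word_cong_catV.
Qed.

HB.instance Definition _ := isGroup.Build presented
  presented_mulA presented_mul1 presented_mulr1 presented_mulV presented_mulrV.

Definition presented_gen (x : X) : presented := presented_class [:: (x, false)].
End Presented.

(* G admits the presentation < X | R >, where the generator x corresponds to
   the element g x of G. *)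
Definition admits_presentation (G : groupType) (X : choiceType) (g : X -> G)
    (R : word X -> word X -> Prop) : Prop :=
  exists f : {multiplicative presented R -> G},
    bijective f /\ forall x, f (presented_gen R x) = g x.

(* Generators are indexed from 0: the generators of index 1, ..., n - 1 are
   represented by the elements 0, ..., n - 2 of 'I_n.-1. *)
Definition artin_letter (n : nat) (i : 'I_n.-1) : 'I_n.-1 * bool := (i, false).

Inductive artin_rel (n : nat) : word 'I_n.-1 -> word 'I_n.-1 -> Prop :=
| artin_comm (i j : 'I_n.-1) : (`|i - j| > 1)%N ->
    artin_rel [:: artin_letter i; artin_letter j]
              [:: artin_letter j; artin_letter i]
| artin_braid (i j : 'I_n.-1) : j = i.+1 :> nat ->
    artin_rel [:: artin_letter i; artin_letter j; artin_letter i]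
              [:: artin_letter j; artin_letter i; artin_letter j].

Definition braid (n : nat) : groupType := presented (@artin_rel n).

Definition sigma (n : nat) (i : 'I_n.-1) : braid n :=
  presented_gen (@artin_rel n) i.

(* inl i is the braid generator of index i, inr i the clasp generator. *)
Definition clasp_gen (n : nat) : choiceType := ('I_n.-1 + 'I_n.-1)%type.

Definition s_ (n : nat) (i : 'I_n.-1) : clasp_gen n * bool := (inl i, false).
Definition p_ (n : nat) (i : 'I_n.-1) : clasp_gen n * bool := (inr i, false).

Inductive clasp_rel (n : nat) : word (clasp_gen n) -> word (clasp_gen n) -> Prop :=
| clasp_rel1 (i j : 'I_n.-1) : (`|i - j| > 1)%N ->
    clasp_rel [:: s_ i; s_ j] [:: s_ j; s_ i]
| clasp_rel2 (i j : 'I_n.-1) : j = i.+1 :> nat ->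
    clasp_rel [:: s_ i; s_ j; s_ i] [:: s_ j; s_ i; s_ j]
| clasp_rel3 (i j : 'I_n.-1) : j = i.+2 :> nat ->
    clasp_rel [:: p_ i; p_ j] [:: p_ j; p_ i]
| clasp_rel4 (i j : 'I_n.-1) : j = i.+1 :> nat ->
    clasp_rel [:: s_ i; p_ j; s_ i; p_ j] [:: p_ j; s_ i; p_ j; s_ i]
| clasp_rel5 (i j : 'I_n.-1) : (`|i - j| > 1)%N ->
    clasp_rel [:: p_ i; s_ j] [:: s_ j; p_ i]
| clasp_rel6 (i : 'I_n.-1) :
    clasp_rel [:: p_ i; s_ i] [:: s_ i; p_ i]
| clasp_rel7 (i j : 'I_n.-1) : j = i.+1 :> nat ->
    clasp_rel [:: p_ i; s_ j; s_ i] [:: s_ j; s_ i; p_ j]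
| clasp_rel8 (i j : 'I_n.-1) : j = i.+1 :> nat ->
    clasp_rel [:: s_ i; s_ j; p_ i] [:: p_ j; s_ i; s_ j]
| clasp_rel9 (i : 'I_n.-1) :
    clasp_rel [:: p_ i] [:: s_ i; s_ i].

Definition clasp_val (n : nat) (x : clasp_gen n) : braid n :=
  match x with
  | inl i => sigma i
  | inr i => sigma i ^+ 2
  end.

(* Main.v *)
(* Relation 9 makes the clasp generators redundant, so it suffices that the
   other relations involving them hold in the braid group with
   p_i = sigma_i ^ 2.  The universal property of presented groups then yields
   homomorphisms in both directions, mutually inverse on the generators. *)
Require Import Defs.
From HB Require Import structures.
From mathcomp Require Import all_boot ssrint zify.

Set Implicit Arguments.
Unset Strict Implicit.
Unset Printing Implicit Defensive.

Local Open Scope group_scope.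

Section WordEval.
Variables (X : Type) (G : groupType) (g : X -> G).

Definition word_eval (w : word X) : G :=
  \prod_(l <- w) (if l.2 then (g l.1)^-1 else g l.1).

Lemma word_eval_cat (u v : word X) :
  word_eval (u ++ v) = word_eval u * word_eval v.
Proof. exact: big_cat. Qed.

(** Free cancellation holds in every group, so only the defining relations have to be checked. *)
Lemma word_eval_cong (R : word X -> word X -> Prop) (u v : word X) :
  (forall u v, R u v -> word_eval u = word_eval v) ->
  word_cong R u v -> word_eval u = word_eval v.
Proof.
move=> evalR; elim=> //.
- by move=> {}u {}v w _ -> _ ->.
- by move=> {}u u' {}v v' _ equ _ eqv; rewrite !word_eval_cat equ eqv.
- move=> x b; rewrite /word_eval !big_cons big_nil mulg1.
  by case: b => /=; rewrite ?mulgV ?mulVg.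
Qed.

End WordEval.

Lemma word_eval_comp (X : Type) (G H : groupType)
    (f : UMagmaMorphism.type G H) (g : X -> G) (w : word X) :
  word_eval (f \o g) w = f (word_eval g w).
Proof.
rewrite /word_eval gmulf_prod; apply: eq_bigr => -[x []] _ //=.
by rewrite gmulfV.
Qed.

Section UniversalProperty.
Variables (X : choiceType) (R : word X -> word X -> Prop) (G : groupType).

Lemma presented_class_cat (u v : word X) :
  presented_class R (u ++ v) = presented_class R u * presented_class R v.
Proof. exact/esym/presented_mul_class. Qed.

Lemma word_eval_presented_gen (w : word X) :
  word_eval (@presented_gen X R) w = presented_class R w.
Proof.
elim: w => [|[x b] w IHw]; first exact: big_nil.
rewrite -cat1s word_eval_cat presented_class_cat IHw; congr (_ * _).
rewrite /word_eval big_cons big_nil mulg1; case: b => //=.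
(* The class of an inverse letter is the inverse of the generator: multiplying by the generator on
   the left leaves one free cancellation. *)
apply: (mulgI (presented_gen R x)).
rewrite mulgV -presented_class_cat; apply/esym/presented_classP.
exact: (word_cong_cancel R x false).
Qed.

Lemma word_eval_rel (u v : word X) :
  R u v -> word_eval (@presented_gen X R) u = word_eval (@presented_gen X R) v.
Proof.
move=> Ruv; rewrite !word_eval_presented_gen.
exact/presented_classP/word_cong_rel.
Qed.

(** Von Dyck's theorem: evaluating a chosen representative word is independent of the choice, by
    [word_eval_cong]. *)
Lemma presented_lift (g : X -> G) :
  (forall u v, R u v -> word_eval g u = word_eval g v) ->
  exists f : UMagmaMorphism.type (presented R) G,
    forall x, f (presented_gen R x) = g x.
Proof.
move=> evalR; pose f (a : presented R) := word_eval g (repr a).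
have fE w : f (presented_class R w) = word_eval g w.
  exact: (word_eval_cong evalR (repr_presented_class R w)).
have fM : monoid_morphism f.
  split=> [|a b]; first by rewrite fE /word_eval big_nil.
  rewrite -[a]presented_classK -[b]presented_classK.
  by rewrite -presented_class_cat !fE word_eval_cat.
pose fmor := isUMagmaMorphism.Build _ _ f fM.
exists (HB.pack_for (UMagmaMorphism.type (presented R) G) f fmor) => x /=.
by rewrite fE /word_eval big_cons big_nil mulg1.
Qed.

(** Every element is the value of a word in the generators, and homomorphisms commute with
    evaluation. *)
Lemma presented_eq_hom (f h : UMagmaMorphism.type (presented R) G) :
  (forall x, f (presented_gen R x) = h (presented_gen R x)) -> f =1 h.
Proof.
move=> fh a; rewrite -[a]presented_classK -word_eval_presented_gen.
rewrite -!word_eval_comp; apply: eq_bigr => -[x b] _ /=.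
by rewrite fh.
Qed.

End UniversalProperty.

Section BraidRelation.
Variables (G : groupType) (a b : G).
Hypothesis aba : a * b * a = b * a * b.

(** Two braid moves: [a(aba) = a(bab) = (aba)b = (bab)b]. *)
Lemma braid_sqr_l : a ^+ 2 * b * a = b * a * b ^+ 2.
Proof. by rewrite !expg2 -!mulgA [a * (b * a)]mulgA aba !mulgA aba. Qed.

(** Two braid moves: [(aba)a = (bab)a = b(aba) = b(bab)]. *)
Lemma braid_sqr_r : a * b * a ^+ 2 = b ^+ 2 * a * b.
Proof. by rewrite !expg2 !mulgA aba -!mulgA [a * (b * a)]mulgA aba !mulgA. Qed.

Lemma braid_sqr_comm : a * b ^+ 2 * a * b ^+ 2 = b ^+ 2 * a * b ^+ 2 * a.
Proof.
transitivity (a * b * (b * a * b ^+ 2)); first by rewrite !expg2 !mulgA.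
(* The factor [b a b^2] becomes [a^2 b a]; its [a^2] joins the leading [a b], and [a b a^2] turns
   into [b^2 a b]. *)
rewrite -braid_sqr_l -[_ * b * a]mulgA [a * b * _]mulgA braid_sqr_r.
by rewrite !expg2 !mulgA.
Qed.

End BraidRelation.

Lemma sigma_comm (n : nat) (i j : 'I_n.-1) :
  (`|i - j| > 1)%N -> sigma i * sigma j = sigma j * sigma i.
Proof.
move=> /(@artin_comm n)/word_eval_rel.
by rewrite /word_eval !big_cons !big_nil !mulg1 ?mulgA.
Qed.

Lemma sigma_braid (n : nat) (i j : 'I_n.-1) : j = i.+1 :> nat ->
  sigma i * sigma j * sigma i = sigma j * sigma i * sigma j.
Proof.
move=> /(@artin_braid n)/word_eval_rel.
by rewrite /word_eval !big_cons !big_nil !mulg1 ?mulgA.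
Qed.

Lemma clasp_rel_val (n : nat) (u v : word (clasp_gen n)) :
  clasp_rel u v -> word_eval (@clasp_val n) u = word_eval (@clasp_val n) v.
Proof.
case=> [i j ij|i j ij|i j ij|i j ij|i j ij|i|i j ij|i j ij|i];
  rewrite /word_eval !big_cons !big_nil /= !mulg1.
- exact: sigma_comm.
- by rewrite !mulgA; apply: sigma_braid.
(* Indices two apart already satisfy the far commutation condition, and squares of commuting
   elements commute. *)
- by apply/commuteX2/sigma_comm; rewrite ij; lia.
  (* [!mulgA] would also match inside [x ^+ 2], which converts to [x * x]. *)
- rewrite 2!mulgA 2![RHS]mulgA.
  exact/braid_sqr_comm/sigma_braid.
- exact/commute_sym/commuteX/commute_sym/sigma_comm.
- exact/commute_sym/commuteX.
- by rewrite mulgA [RHS]mulgA; apply/braid_sqr_l/sigma_braid.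
- by rewrite mulgA [RHS]mulgA; apply/braid_sqr_r/sigma_braid.
- exact: expg2.
Qed.

Theorem theorem5p2 (n : nat) :
  admits_presentation (@clasp_val n) (@clasp_rel n).
Proof.
pose s (i : 'I_n.-1) := presented_gen (@clasp_rel n) (inl i).
have [f fE] := presented_lift (@clasp_rel_val n).
(* The inverse map exists because the Artin relations appear among the clasp relations as
   [clasp_rel1] and [clasp_rel2]. *)
have [|h hE] := @presented_lift _ (@artin_rel n) _ s.
  move=> _ _ [i j ij|i j ij].
    have := word_eval_rel (clasp_rel1 ij).
    by rewrite /word_eval !big_cons !big_nil.
  have := word_eval_rel (clasp_rel2 ij).
  by rewrite /word_eval !big_cons !big_nil.
exists f; split=> //; exists h.
  apply: (@presented_eq_hom _ _ _ (h \o f) idfun) => -[i|i] /=.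
    by rewrite fE hE.
  (* A clasp generator is sent to the square of [s i], which [clasp_rel9] identifies with that
     generator. *)
  rewrite fE /= gmulfXn hE expg2; have := word_eval_rel (clasp_rel9 i).
  by rewrite /word_eval !big_cons !big_nil /= !mulg1.
by apply: (@presented_eq_hom _ _ _ (f \o h) idfun) => i /=; rewrite hE fE.
Qed.
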